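(* Let $\Lambda_{TT}=\{(F(x),\Lambda_x,v(x))\}_{x\in X}$ be a continuous $(T,T)$-controlled $g$-fusion Bessel family for $H$ with bound $B$ and $\Gamma_{UU}=\{(G(x),\Gamma_x,w(x))\}_{x\in X}$ a continuous $(U,U)$-controlled $g$-fusion Bessel family for $H$ with bound $D$. Let $S_{\Lambda T\Gamma U}:H\to H$ be the frame operator for this pair, defined by $$\langle S_{\Lambda T\Gamma U}f,g\rangle=\int_X v(x)w(x)\,\langle U P_{G(x)}\Gamma_x^*\Lambda_xP_{F(x)}Tf,\,g\rangle\,d\mu_x,\qquad f,g\in H.$$ Then $S_{\Lambda T\Gamma U}$ is a well-defined and bounded operator with $\|S_{\Lambda T\Gamma U}\|\le\sqrt{BD}$.
   Context: $H$ is a separable Hilbert space, $\mathbb H$ is the collection of all closed subspaces of $H$, and $(X,\mu)$ is a measure space with positive measure $\mu$; $d\mu_x$ denotes integration with respect to $\mu$ in the variable $x$. $P_M$ is the orthogonal projection of $H$ onto a closed subspace $M$ (when followed by an operator defined on $M$ it is regarded as a map $H\to M$; its adjoint is then the inclusion $M\to H$). An operator is positive if it is self-adjoint and $\langle Sf,f\rangle\ge 0$ for all $f$; $\mathcal{GB}^+(H)$ is the set of positive bounded operators on $H$ with bounded inverse. Here $T,U\in\mathcal{GB}^+(H)$; $F,G:X\to\mathbb H$ are weakly measurable (for each $f\in H$, $x\mapsto P_{F(x)}f$ and $x\mapsto P_{G(x)}f$ are measurable); $v,w:X\to\mathbb R^+$ are measurable; $\{K_x\}_{x\in X}$ are Hilbert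 spaces; and $\Lambda_x:F(x)\to K_x$, $\Gamma_x:G(x)\to K_x$ are bounded linear for each $x\in X$. $\Lambda_{TT}$ is a continuous $(T,T)$-controlled $g$-fusion Bessel family with bound $B<\infty$ if $\int_X v^2(x)\langle\Lambda_xP_{F(x)}Tf,\Lambda_xP_{F(x)}Tf\rangle\,d\mu_x\le B\|f\|^2$ for all $f\in H$; $\Gamma_{UU}$ is a continuous $(U,U)$-controlled $g$-fusion Bessel family with bound $D<\infty$ if $\int_X w^2(x)\langle\Gamma_xP_{G(x)}Uf,\Gamma_xP_{G(x)}Uf\rangle\,d\mu_x\le D\|f\|^2$ for all $f\in H$. The integrands occurring in these formulas and in the definition of $S_{\Lambda T\Gamma U}$ are understood to be measurable. *)

(* Defs.v *)
From HB Require Import structures.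
From mathcomp Require Import all_boot all_order all_algebra complex.
From mathcomp Require Import all_classical all_reals all_analysis.

Set Implicit Arguments.
Unset Strict Implicit.
Unset Printing Implicit Defensive.

Import Order.TTheory GRing.Theory Num.Theory.
Import numFieldNormedType.Exports.

Local Open Scope classical_set_scope.
Local Open Scope ring_scope.

(** Hilbert spaces are treated uniformly over the real and complex scalars.   *)

Variant scalar_kind := RealScalars | ComplexScalars.

Definition scalar (R : realType) (k : scalar_kind) : numFieldType :=
  match k with
  | RealScalars => R
  | ComplexScalars => R[i]
  end.

Definition sRe (R : realType) (k : scalar_kind) : scalar R k -> R :=
  match k return scalar R k -> R with
  | RealScalars => fun z => z
  | ComplexScalars => fun z => complex.Re z
  end.

Definition sIm (R : realType) (k : scalar_kind) : scalar R k -> R :=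
  match k return scalar R k -> R with
  | RealScalars => fun=> 0
  | ComplexScalars => fun z => complex.Im z
  end.

Definition sconj (R : realType) (k : scalar_kind) : scalar R k -> scalar R k :=
  match k return scalar R k -> scalar R k with
  | RealScalars => fun z => z
  | ComplexScalars => fun z => conjc z
  end.

(** [mkscalar k a b] is [a + i b]; the imaginary part is dropped over the
    reals, where it is only ever used with [b = 0]. *)
Definition mkscalar (R : realType) (k : scalar_kind) : R -> R -> scalar R k :=
  match k return R -> R -> scalar R k with
  | RealScalars => fun a _ => a
  | ComplexScalars => fun a b => Complex a b
  end.

(** The inner product is linear in its first argument and conjugate-linear in
    the second one. *)
HB.mixin Record isHilbert (R : realType) (k : scalar_kind) H
    & CompleteNormedModule (scalar R k) H := {
  inner : {dot H for @sconj R k} ;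
  sqr_norm_inner : forall x : H, `|x| ^+ 2 = inner x x
}.

#[short(type="hilbertType")]
HB.structure Definition Hilbert (R : realType) (k : scalar_kind) :=
  {H of CompleteNormedModule (scalar R k) H & isHilbert R k H}.

Section closed_subspace.
Context (R : realType) (k : scalar_kind) (H : hilbertType R k).

Record closed_subspace := ClosedSubspace {
  csub_set :> set H ;
  csub_submod : submod_closed (mem csub_set) ;
  csub_closed : closed csub_set
}.

Context (M : closed_subspace).

(** The elements of [M], as a Hilbert space of its own. *)
Record csub_elt := CsubElt {
  csub_val :> H ;
  csub_valP : csub_val \in csub_set M
}.

HB.instance Definition _ := [isSub for csub_val].
HB.instance Definition _ := [Choice of csub_elt by <:].
HB.instance Definition _ := GRing.SubChoice_isSubLmodule.Build _ _ _
  csub_elt (GRing.submod_closed_semi (csub_submod M)).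

Let norm_csub (x : csub_elt) : scalar R k := `|csub_val x|.

Fact csub_ler_normD x y : norm_csub (x + y) <= norm_csub x + norm_csub y.
Proof. exact: ler_normD. Qed.

Fact csub_normrZ (l : scalar R k) x : norm_csub (l *: x) = `|l| * norm_csub x.
Proof. exact: normrZ. Qed.

Fact csub_normr0_eq0 x : norm_csub x = 0 -> x = 0.
Proof. by move=> /normr0_eq0 x0; apply: val_inj. Qed.

HB.instance Definition _ := Lmodule_isNormed.Build (scalar R k) csub_elt
  csub_ler_normD csub_normrZ csub_normr0_eq0.

Fact csub_cauchy_cvg (F : set_system csub_elt) :
  ProperFilter F -> cauchy F -> cvg F.
Proof.
move=> FF Fc.
have Gc : cauchy (csub_val @ F).
  apply/cauchy_ballP => e e0.
  have /cauchy_ballP/(_ e e0) := Fc.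
  case=> -[A B] /= [FA FB] AB; exists (csub_val @` A, csub_val @` B) => /=.
    split; [apply: filterS FA|apply: filterS FB] => x ? /=; by exists x.
  move=> [_ _] /= [[x Ax <-] [y By <-]].
  by have := AB (x, y) (conj Ax By); rewrite -!ball_normE.
have /cvg_ex[l Gl] : cvg (csub_val @ F) by exact: cauchy_cvg Gc.
have Ml : l \in csub_set M.
  rewrite inE; suff : closure (csub_set M) l by apply: csub_closed.
  move=> B /Gl FB; have [x Bx] := filter_ex (FB : F (csub_val @^-1` B)).
  by exists (csub_val x); split => //; rewrite -inE; exact: csub_valP.
apply/cvg_ex; exists (CsubElt Ml).
apply/cvgrPdist_lt => e e0.
have /cvgrPdist_lt/(_ e e0) := Gl.
by apply: filterS => x.
Qed.

HB.instance Definition _ := Uniform_isComplete.Build csub_elt csub_cauchy_cvg.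

Definition csub_inner (x y : csub_elt) : scalar R k :=
  inner (csub_val x) (csub_val y).

Fact csub_inner_zmodl y : zmod_morphism (csub_inner ^~ y).
Proof. by move=> x x'; exact: zmod_morphisml_subproof. Qed.

Fact csub_inner_zmodr x : zmod_morphism (csub_inner x).
Proof. by move=> y y'; exact: zmod_morphismr_subproof. Qed.

Fact csub_inner_scalel y : scalable_for *%R (csub_inner ^~ y).
Proof. by move=> a x; exact: linearl_subproof. Qed.

Fact csub_inner_scaler x :
  scalable_for (@sconj R k \; *%R) (csub_inner x).
Proof. by move=> a y; exact: linearr_subproof. Qed.

Fact csub_inner_herm x y :
  csub_inner x y = (-1) ^+ false * sconj (csub_inner y x).
Proof. exact: hermitian_subproof. Qed.

Fact csub_inner_gt0 x : x != 0 -> 0 < csub_inner x x.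
Proof. by move=> x0; apply: neq0_dnorm_gt0. Qed.

HB.instance Definition _ := isBilinear.Build _ csub_elt csub_elt _ _ _
  csub_inner csub_inner_zmodl csub_inner_zmodr
  csub_inner_scalel csub_inner_scaler.
HB.instance Definition _ := isHermitianSesquilinear.Build _ csub_elt
  false (@sconj R k) csub_inner csub_inner_herm.
HB.instance Definition _ := isDotProduct.Build _ csub_elt
  csub_inner csub_inner_gt0.

Fact csub_sqr_norm (x : csub_elt) :
  `|x| ^+ 2 = (csub_inner : {dot csub_elt for @sconj R k}) x x.
Proof. exact: sqr_norm_inner. Qed.

HB.instance Definition _ := isHilbert.Build R k csub_elt csub_sqr_norm.

End closed_subspace.

(** [csub_val] is the adjoint of [orth_proj M : H -> M]. *)
Definition orth_proj (R : realType) (k : scalar_kind) (H : hilbertType R k)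
    (M : closed_subspace H) (f : H) : csub_elt M :=
  xget 0 [set p | forall m : csub_elt M,
                    inner (f - csub_val p) (csub_val m) = 0].

Definition adjoint (R : realType) (k : scalar_kind) (H1 H2 : hilbertType R k)
    (A : H1 -> H2) (y : H2) : H1 :=
  xget 0 [set z | forall x, inner (A x) y = inner x z].

Definition separable_space (T : topologicalType) :=
  exists A : set T, countable A /\ dense A.

(** The norm of [H] takes its values in [scalar R k]; [hnorm] is the same norm
    with values in [R]. *)
Definition hnorm (R : realType) (k : scalar_kind) (H : hilbertType R k)
    (f : H) : R :=
  sRe `|f|.

Definition bounded_operator (R : realType) (k : scalar_kind)
    (H1 H2 : hilbertType R k) (A : H1 -> H2) :=
  exists C : R, forall f, hnorm (A f) <= C * hnorm f.

(** Only meaningful on bounded operators: [sup] of an unbounded set is [0]. *)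
Definition opnorm (R : realType) (k : scalar_kind) (H1 H2 : hilbertType R k)
    (A : H1 -> H2) : R :=
  sup [set hnorm (A f) | f in [set f | hnorm f <= 1]].

Definition positive_operator (R : realType) (k : scalar_kind)
    (H : hilbertType R k) (T : H -> H) :=
  (forall f g, inner (T f) g = inner f (T g)) /\
  (forall f, 0 <= inner (T f) f).

(** The class GB^+(H). *)
Definition GBplus (R : realType) (k : scalar_kind) (H : hilbertType R k)
    (T : {linear H -> H}) :=
  [/\ positive_operator T,
      bounded_operator T &
      exists T' : {linear H -> H},
        [/\ bounded_operator T', cancel T T' & cancel T' T]].

Definition borel (H : ptopologicalType) := g_sigma_algebraType (@open H).

Section families.
Context (R : realType) (k : scalar_kind) (H : hilbertType R k).
Context (d : measure_display) (X : measurableType d).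
Context (mu : {measure set X -> \bar R}).

Definition weakly_measurable (F : X -> closed_subspace H) :=
  forall f : H, measurable_fun [set: X]
    (fun x => csub_val (orth_proj (F x) f) : borel H).

(** Integration of scalar-valued functions, through real and imaginary
    parts. *)
Definition smeasurable (h : X -> scalar R k) :=
  measurable_fun [set: X] (fun x => sRe (h x)) /\
  measurable_fun [set: X] (fun x => sIm (h x)).

Definition sintegrable (h : X -> scalar R k) :=
  mu.-integrable [set: X] (fun x => (sRe (h x))%:E) /\
  mu.-integrable [set: X] (fun x => (sIm (h x))%:E).

Definition sintegral (h : X -> scalar R k) : scalar R k :=
  mkscalar k (\int[mu]_x sRe (h x)) (\int[mu]_x sIm (h x)).

Context (K : X -> hilbertType R k).

(** The inner product of a vector with itself is real, so that [sRe] loses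
    nothing here. *)
Definition bessel_integrand (T : H -> H) (F : X -> closed_subspace H)
    (Lambda : forall x, csub_elt (F x) -> K x) (v : X -> R) (f : H) (x : X) : R :=
  v x ^+ 2 * sRe (inner (Lambda x (orth_proj (F x) (T f)))
                        (Lambda x (orth_proj (F x) (T f)))).

Definition gfusion_bessel (T : H -> H) (F : X -> closed_subspace H)
    (Lambda : forall x, csub_elt (F x) -> K x) (v : X -> R) (B : R) :=
  forall f : H,
    measurable_fun [set: X] (bessel_integrand T Lambda v f) /\
    (\int[mu]_x (bessel_integrand T Lambda v f x)%:E
       <= (B * hnorm f ^+ 2)%:E)%E.

Definition frame_integrand (T U : H -> H) (F G : X -> closed_subspace H)
    (Lambda : forall x, csub_elt (F x) -> K x)
    (Gamma : forall x, csub_elt (G x) -> K x)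
    (v w : X -> R) (f g : H) (x : X) : scalar R k :=
  mkscalar k (v x * w x) 0 *
  inner (U (orth_proj (G x)
             (adjoint (Gamma x) (Lambda x (orth_proj (F x) (T f)))))) g.

Definition is_frame_operator (T U : H -> H) (F G : X -> closed_subspace H)
    (Lambda : forall x, csub_elt (F x) -> K x)
    (Gamma : forall x, csub_elt (G x) -> K x)
    (v w : X -> R) (S : H -> H) :=
  forall f g : H,
    inner (S f) g = sintegral (frame_integrand T U Lambda Gamma v w f g).

End families.

(* Main.v *)
Require Import Defs.
From HB Require Import structures.
From mathcomp Require Import all_boot all_order all_algebra complex.
From mathcomp Require Import all_classical all_reals all_analysis.
From mathcomp Require Import measurable_realfun ring lra.

Set Implicit Arguments.
Unset Strict Implicit.
Unset Printing Implicit Defensive.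

Import Order.TTheory GRing.Theory Num.Theory.
Import numFieldNormedType.Exports.

Local Open Scope classical_set_scope.
Local Open Scope ring_scope.

(** Write [L x f] for [Lambda x (P_F(x) (T f))] and [M x g] for
    [Gamma x (P_G(x) (U g))].  Moving the self-adjoint operator [U], the
    projection on [G x] and the adjoint of [Gamma x] to the right-hand side of
    the inner product turns the integrand into [v x * w x * <L x f, M x g>]
    ([frame_integrandE]).  It is therefore linear in [f], conjugate-linear in
    [g] and pointwise bounded by [(v x |L x f|) * (w x |M x g|)], a product of
    two functions whose squares have integrals at most [B |f|^2] and
    [D |g|^2] by the Bessel hypotheses.  The Cauchy-Schwarz inequality for
    integrals ([integral_cauchy_schwarz]) gives integrability and the bound
    [sqrt (B D) |f| |g|] on the real part of the integral.  A bounded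
    sesquilinear form comes from a unique operator, and a bound on the real
    part of the form is enough to bound its norm, because the value of the form
    at [(f, S f)] is the real number [|S f|^2] ([bounded_form_operator]).

    Orthogonal projections, adjoints and the operator of a form all exist by
    the Riesz representation theorem ([riesz_representation]); the projection
    on [M] is the case of the functional [m |-> <m, f>] on the Hilbert space
    [M].  That theorem is proved by minimising [|x|^2 - 2 Re (phi x)], which
    only involves real numbers and so treats real and complex Hilbert spaces
    alike.

    The elementary fact that a quadratic polynomial which is nonnegative on the
    real line has a nonpositive discriminant ([discriminant_le]) is what turns
    minimality into the representation formula, and it gives both
    Cauchy-Schwarz inequalities. *)

(** * Real and imaginary parts of scalars *)

Section ScalarParts.
Context (R : realType) (k : scalar_kind).
Implicit Types a b : Defs.scalar R k.

Lemma scalar_ext a b : sRe a = sRe b -> sIm a = sIm b -> a = b.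
Proof. by case: k a b => //= -[a1 a2] [b1 b2] /= -> ->. Qed.

Lemma sReD a b : sRe (a + b) = sRe a + sRe b.
Proof. by case: k a b => //= -[a1 a2] [b1 b2]. Qed.

Lemma sImD a b : sIm (a + b) = sIm a + sIm b.
Proof. by case: k a b => [a b|[a1 a2] [b1 b2]] //=; rewrite addr0. Qed.

Lemma sReM a b : sRe (a * b) = sRe a * sRe b - sIm a * sIm b.
Proof.
by case: k a b => [a b|[a1 a2] [b1 b2]] //=; rewrite mulr0 subr0.
Qed.

Lemma sImM a b : sIm (a * b) = sRe a * sIm b + sIm a * sRe b.
Proof.
by case: k a b => [a b|[a1 a2] [b1 b2]] //=; rewrite mulr0 mul0r addr0.
Qed.

Lemma sReN a : sRe (- a) = - sRe a.
Proof. by case: k a => // -[]. Qed.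

Lemma sRe_conj a : sRe (sconj a) = sRe a.
Proof. by case: k a => // -[]. Qed.

Lemma sIm_conj a : sIm (sconj a) = - sIm a.
Proof. by case: k a => [a|[]] //=; rewrite oppr0. Qed.

Lemma sconjK a : sconj (sconj a) = a.
Proof. by apply: scalar_ext; rewrite ?sRe_conj ?sIm_conj ?opprK. Qed.

Lemma sconjD a b : sconj (a + b) = sconj a + sconj b.
Proof.
by apply: scalar_ext; rewrite ?(sRe_conj, sIm_conj, sReD, sImD) ?opprD.
Qed.

Lemma sconjM a b : sconj (a * b) = sconj a * sconj b.
Proof.
apply: scalar_ext; rewrite ?(sRe_conj, sIm_conj, sReM, sImM).
  by rewrite mulrNN.
by rewrite mulrN mulNr opprD.
Qed.

Lemma sRe_mk (r s : R) : sRe (mkscalar k r s) = r.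
Proof. by case: k. Qed.

Lemma sIm_mk0 (r : R) : sIm (mkscalar k r 0) = 0.
Proof. by case: k. Qed.

Lemma sRe_mkM (r : R) a : sRe (mkscalar k r 0 * a) = r * sRe a.
Proof. by rewrite sReM sRe_mk sIm_mk0 mul0r subr0. Qed.

Lemma sIm_mkM (r : R) a : sIm (mkscalar k r 0 * a) = r * sIm a.
Proof. by rewrite sImM sRe_mk sIm_mk0 mul0r addr0. Qed.

(** Multiplication by [-i] turns the imaginary part into the real part, which
    reduces statements on imaginary parts to real parts; over the reals, where
    [mkscalar k 0 (- 1)] is [0], both sides vanish. *)
Lemma sImE a : sIm a = sRe (mkscalar k 0 (- 1) * a).
Proof.
by case: k a => [a|[a1 a2]] /=; rewrite ?mul0r // sub0r mulN1r opprK.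
Qed.

Lemma ler_sRe a b : a <= b -> sRe a <= sRe b.
Proof. by case: k a b => //= -[a1 a2] [b1 b2]; rewrite lecE => /andP[]. Qed.

Lemma sRe_ge0 a : 0 <= a -> 0 <= sRe a.
Proof. by move=> /ler_sRe; case: k a. Qed.

Lemma sIm_ge0 a : 0 <= a -> sIm a = 0.
Proof. by case: k a => //= -[a1 a2]; rewrite lecE => /andP[/eqP]. Qed.

Lemma ltr_sRe a b : 0 <= a -> 0 <= b -> (a < b) = (sRe a < sRe b).
Proof.
move=> /sIm_ge0 a0 /sIm_ge0 b0.
by case: k a b a0 b0 => //= -[a1 a2] [b1 b2] /= -> ->; rewrite ltcE eqxx.
Qed.

Lemma sRe0 : sRe (0 : Defs.scalar R k) = 0.
Proof. by case: k. Qed.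

Lemma mkscalar1 : mkscalar k 1 0 = 1 :> Defs.scalar R k.
Proof. by case: k. Qed.

Lemma mk_ge0 (r : R) : 0 <= r -> 0 <= mkscalar k r 0.
Proof. by case: k => //= r0; rewrite lecE eqxx. Qed.

Lemma sRe_normNi_le1 : sRe `|@mkscalar R k 0 (- 1)| <= 1.
Proof.
case: k => /=; first by rewrite normr0.
by rewrite expr0n/= add0r sqrrN expr1n sqrtr1.
Qed.

End ScalarParts.

(** * Inner products and the Riesz representation theorem *)

(** The minimum is tested at [t = - b / c]; when [c = 0], the polynomial is
    affine and would take the value [-1] if [b] were not [0]. *)
Lemma discriminant_le (R : realFieldType) (a b c : R) : 0 <= c ->
  (forall t, 0 <= a + 2 * t * b + t ^+ 2 * c) -> b ^+ 2 <= a * c.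
Proof.
rewrite le_eqVlt => /predU1P[<-|c0] abc.
  rewrite mulr0; have [->|b0] := eqVneq b 0; first by rewrite expr0n.
  have := abc (- (a + 1) / (2 * b)).
  suff -> : a + 2 * (- (a + 1) / (2 * b)) * b
            + (- (a + 1) / (2 * b)) ^+ 2 * 0 = - 1 by rewrite oppr_ge0 ler10.
  by field.
have := abc (- b / c).
have -> : a + 2 * (- b / c) * b + (- b / c) ^+ 2 * c = (a * c - b ^+ 2) / c.
  by field; rewrite gt_eqF.
by rewrite pmulr_lge0 ?invr_gt0// subr_ge0.
Qed.

Section InnerProduct.
Context (R : realType) (k : scalar_kind) (H : hilbertType R k).
Implicit Types (x y z : H) (a : Defs.scalar R k).

Lemma innerC x y : inner x y = sconj (inner y x).
Proof. by rewrite hermitian_subproof expr0 mul1r. Qed.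

Lemma innerDl x y z : inner (x + y) z = inner x z + inner y z.
Proof. exact: (@linearDl _ _ _ _ _ _ (@inner R k H)). Qed.

Lemma innerZl a x y : inner (a *: x) y = a * inner x y.
Proof. exact: (@linearl_subproof _ _ _ _ _ _ (@inner R k H)). Qed.

Lemma innerDr x y z : inner x (y + z) = inner x y + inner x z.
Proof. by rewrite innerC innerDl sconjD -!innerC. Qed.

Lemma innerZr a x y : inner x (a *: y) = sconj a * inner x y.
Proof. by rewrite innerC innerZl sconjM -innerC. Qed.

Lemma innerNl x y : inner (- x) y = - inner x y.
Proof. by rewrite -scaleN1r innerZl mulN1r. Qed.

Lemma innerBr x y z : inner x (y - z) = inner x y - inner x z.
Proof. exact: (@linearBr _ _ _ _ _ _ (@inner R k H)). Qed.

Lemma inner_injr x y : (forall z, inner z x = inner z y) -> x = y.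
Proof.
move=> xy; apply/eqP; rewrite -subr_eq0; apply/eqP.
apply: contrapT => /eqP /(@neq0_dnorm_gt0 _ _ _ (@inner R k H)).
by rewrite innerBr xy subrr ltxx.
Qed.

Lemma inner_injl x y : (forall z, inner x z = inner y z) -> x = y.
Proof. by move=> xy; apply: inner_injr => z; rewrite innerC xy -innerC. Qed.

Lemma hnorm_ge0 x : 0 <= hnorm x.
Proof. exact/sRe_ge0. Qed.

Lemma hnormZ a x : hnorm (a *: x) = sRe `|a| * hnorm x.
Proof.
by rewrite /hnorm normrZ sReM (sIm_ge0 (normr_ge0 a)) mul0r subr0.
Qed.

Lemma hnorm_sqr x : hnorm x ^+ 2 = sRe (inner x x).
Proof.
rewrite -sqr_norm_inner expr2 /hnorm [in RHS]expr2 sReM.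
by rewrite (sIm_ge0 (normr_ge0 x)) mulr0 subr0.
Qed.

Lemma hnorm_sqrD (t : R) x y : hnorm (x + mkscalar k t 0 *: y) ^+ 2 =
  hnorm x ^+ 2 + 2 * t * sRe (inner x y) + t ^+ 2 * hnorm y ^+ 2.
Proof.
rewrite !hnorm_sqr !(innerDl, innerDr, innerZl, innerZr) !(sReD, sRe_mkM).
rewrite !sReM sRe_conj sIm_conj sRe_mk sIm_mk0 oppr0 !mul0r !subr0.
rewrite (innerC y x) sRe_conj.
ring.
Qed.

Lemma cauchy_schwarz x y : `|sRe (inner x y)| <= hnorm x * hnorm y.
Proof.
rewrite -ler_sqr ?nnegrE ?mulr_ge0 ?hnorm_ge0// real_normK ?num_real// exprMn.
by apply: discriminant_le (sqr_ge0 _) _ => t; rewrite -hnorm_sqrD sqr_ge0.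
Qed.

(** The imaginary part of [<x, y>] is the real part of [<- i x, y>]. *)
Lemma sIm_inner_le x y : `|sIm (inner x y)| <= hnorm x * hnorm y.
Proof.
rewrite sImE -innerZl (le_trans (cauchy_schwarz _ _))// ler_wpM2r ?hnorm_ge0//.
by rewrite hnormZ ler_piMl ?hnorm_ge0 ?sRe_normNi_le1.
Qed.

(** The representative is the limit of a minimising sequence of the functional
    [J x = |x|^2 - 2 Re (phi x)].  An almost-minimiser almost satisfies the
    representation formula, since [J] cannot decrease much along any line
    ([near_min]), and two almost-minimisers are close to each other, since [J]
    cannot decrease much at their midpoint ([near_close]). *)
Lemma riesz_representation (phi : H -> Defs.scalar R k) (C : R) :
    linear_for *%R phi -> (forall x, `|sRe (phi x)| <= C * hnorm x) ->
  exists z, forall x, phi x = inner x z.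
Proof.
move=> phi_lin phi_bd; pose psi x := sRe (phi x).
have psiD (t : R) x y : psi (x + mkscalar k t 0 *: y) = psi x + t * psi y.
  by rewrite /psi addrC phi_lin sReD sRe_mkM addrC.
pose J x : R := hnorm x ^+ 2 - 2 * psi x.
pose E := range J.
have E_inf : has_inf E.
  split; first by exists (J 0), 0.
  exists (- C ^+ 2) => _ [x _ <-]; rewrite /J.
  have := le_trans (ler_norm _) (phi_bd x); rewrite -/(psi x).
  have := sqr_ge0 (hnorm x - C); nra.
set I := inf E.
have IJ x : I <= J x by apply: ge_inf; [exact: E_inf.2|exists x].
have near_min x e y : J x < I + e ->
    (sRe (inner x y) - psi y) ^+ 2 <= e * hnorm y ^+ 2.
  move=> xe; apply: discriminant_le (sqr_ge0 _) _ => t.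
  have := IJ (x + mkscalar k t 0 *: y); rewrite /J hnorm_sqrD psiD.
  move: xe; rewrite /J; lra.
have near_close x y e : J x < I + e -> J y < I + e ->
    hnorm (x - y) ^+ 2 <= 4 * e.
  set h := x - y; have -> : x = y + mkscalar k 1 0 *: h.
    by rewrite mkscalar1 scale1r /h addrC subrK.
  have := IJ (y + mkscalar k 2^-1 0 *: h).
  rewrite /J !hnorm_sqrD !psiD; lra.
have /choice[u uI] : forall n : nat, exists x, J x < I + n.+1%:R^-1.
  move=> n; have /inf_adherent/(_ E_inf)[_ [x _ <-] xI] : 0 < n.+1%:R^-1 :> R.
    by rewrite invr_gt0.
  by exists x.
have tail (e : R) : 0 < e -> \forall n \near \oo, n.+1%:R^-1 < e.
  by move=> e0; exact: (near_infty_natSinv_lt (PosNum e0)).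
have [z uz] : exists z : H, u n @[n --> \oo] --> z.
  apply/cvg_ex; apply: cauchy_cvg; apply: cauchy_exP => e e0.
  have d0 : 0 < sRe e ^+ 2 / 4.
    rewrite divr_gt0// exprn_gt0//.
    by have := ltr_sRe (lexx 0) (ltW e0); rewrite e0 sRe0.
  have [N _ /(_ N (leqnn N)) /= Ne] := tail _ d0.
  exists (u N), N => // n /= Nn.
  rewrite -ball_normE /= ltr_sRe ?(ltW e0)//.
  rewrite -/(hnorm _) -ltr_sqr ?nnegrE ?hnorm_ge0 ?sRe_ge0 ?(ltW e0)//.
  apply: (@le_lt_trans _ _ (4 * N.+1%:R^-1)); last first.
    by rewrite mulrC -ltr_pdivlMr.
  apply: near_close; first exact: uI.
  by rewrite (lt_le_trans (uI n))// lerD2l lef_pV2 ?posrE// ler_nat.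
exists z => x.
(* The imaginary part of [phi x] is the real part of [phi (- i x)]. *)
suff psiE y : sRe (phi y) = sRe (inner y z).
  have phiZ a : phi (a *: x) = a * phi x.
    have phi0 : phi 0 = 0.
      apply: (addrI (phi 0)); rewrite addr0 -[X in X + _]mul1r -phi_lin.
      by rewrite scaler0 addr0.
    by rewrite -[a *: x]addr0 phi_lin phi0 addr0.
  apply: scalar_ext; first exact: psiE.
  by rewrite !sImE -phiZ psiE innerZl.
rewrite innerC sRe_conj.
apply/eqP; rewrite -subr_eq0 -normr_eq0 eq_le normr_ge0.
rewrite andbT; apply/ler_addgt0Pr => e e0; rewrite add0r.
(* The error has two terms of size [d * |y|]; the [+ 1] allows [y = 0]. *)
pose d := e / (2 * (hnorm y + 1)).
have y1 : 0 < hnorm y + 1 by rewrite ltr_wpDl ?hnorm_ge0.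
have d0 : 0 < d by rewrite divr_gt0// mulr_gt0.
have dE : d * hnorm y + d * hnorm y <= e.
  have -> : e = d * (2 * (hnorm y + 1)) by rewrite /d divfK// gt_eqF ?mulr_gt0.
  by move: d0 y1; nra.
have sd0 : 0 < mkscalar k d 0 by rewrite ltr_sRe ?sRe0 ?sRe_mk// mk_ge0 // ltW.
have /cvgrPdist_lt/(_ _ sd0) zu := uz.
have d20 : 0 < d ^+ 2 by rewrite exprn_gt0.
have [n [/= zn nd]] := filter_ex (filterI zu (tail _ d20)).
have {}zn : hnorm (z - u n) < d.
  by move: zn; rewrite ltr_sRe ?mk_ge0 ?(ltW d0)// sRe_mk.
apply: le_trans dE.
have -> : psi y - sRe (inner z y) =
    - (sRe (inner (u n) y) - psi y) - sRe (inner (z - u n) y).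
  by rewrite innerDl innerNl sReD sReN; ring.
rewrite (le_trans (ler_normB _ _))// normrN lerD//.
  rewrite -ler_sqr ?nnegrE ?(mulr_ge0 (ltW d0)) ?hnorm_ge0//.
  rewrite real_normK ?num_real// exprMn.
  apply: near_min; rewrite (lt_le_trans (uI n))// lerD2l; exact: ltW.
apply: le_trans (cauchy_schwarz _ _) _.
by rewrite ler_wpM2r ?hnorm_ge0// ltW.
Qed.

End InnerProduct.

(** * Projections, adjoints and operators of bounded forms *)

Section Operators.
Context (R : realType) (k : scalar_kind).
Implicit Types H : hilbertType R k.

(** [orth_proj] and [adjoint] select a vector by a property and default to [0];
    the content of the next lemma and of [inner_adjoint] is that such a vector
    exists, by Riesz representation on [M] and on [H1] respectively. *)
Lemma inner_orth_proj H (M : closed_subspace H) (f : H) (m : csub_elt M) :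
  inner (orth_proj M f) m = inner f (csub_val m).
Proof.
pose phi (m : csub_elt M) := inner (csub_val m) f.
have phi_lin : linear_for *%R phi by move=> a x y; rewrite -innerZl -innerDl.
have phi_bd x : `|sRe (phi x)| <= hnorm f * hnorm x.
  by rewrite mulrC; exact: cauchy_schwarz.
have [p phiE] := riesz_representation phi_lin phi_bd.
have ex_p : exists p : csub_elt M, forall m : csub_elt M,
    inner (f - csub_val p) (csub_val m) = 0.
  exists p => n; rewrite innerDl innerNl (innerC f) -/(phi n) phiE.
  by rewrite -innerC subrr.
have := xgetPex 0 ex_p m; rewrite -/(orth_proj M f) innerDl innerNl.
by move=> /eqP; rewrite subr_eq0 => /eqP ->.
Qed.

Lemma orth_proj_linear H (M : closed_subspace H) : linear (@orth_proj R k H M).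
Proof.
move=> a f g; apply: inner_injl => m.
by rewrite innerDl innerZl !inner_orth_proj innerDl innerZl.
Qed.

Lemma inner_adjoint H1 H2 (A : {linear H1 -> H2}) (x : H1) (y : H2) :
  bounded_operator A -> inner (A x) y = inner x (adjoint A y).
Proof.
move=> [C AC]; pose phi x := inner (A x) y.
have phi_lin : linear_for *%R phi.
  by move=> a u u'; rewrite /phi linearP innerDl innerZl.
have phi_bd u : `|sRe (phi u)| <= (C * hnorm y) * hnorm u.
  apply: le_trans (cauchy_schwarz _ _) _.
  by rewrite mulrAC ler_wpM2r ?hnorm_ge0.
exact: (xgetPex 0 (riesz_representation phi_lin phi_bd)).
Qed.

(** [S f] represents the functional conjugate to [b f].  The norm of [S f] is
    bounded by taking [g = S f], where [b f g] is the real number [|S f|^2]. *)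
Lemma bounded_form_operator H (b : H -> H -> Defs.scalar R k) (C : R) :
    0 <= C -> (forall g, linear_for *%R (b ^~ g)) ->
    (forall f, linear_for (@sconj R k \; *%R) (b f)) ->
    (forall f g, `|sRe (b f g)| <= C * (hnorm f * hnorm g)) ->
  exists S : {linear H -> H},
    (forall f g, inner (S f) g = b f g) /\ forall f, hnorm (S f) <= C * hnorm f.
Proof.
move=> C0 b_linl b_linr b_bd.
have /choice[S SE] f : exists z, forall g, inner z g = b f g.
  pose phi g := sconj (b f g).
  have phi_lin : linear_for *%R phi.
    by move=> a g g'; rewrite /phi b_linr sconjD sconjM sconjK.
  have phi_bd g : `|sRe (phi g)| <= (C * hnorm f) * hnorm g.
    by rewrite sRe_conj -mulrA.
  have [z zE] := riesz_representation phi_lin phi_bd.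
  by exists z => g; rewrite innerC -zE sconjK.
have S_lin : linear S.
  move=> a f f'; apply: inner_injl => g.
  by rewrite innerDl innerZl !SE b_linl.
pose SL : {linear H -> H} := HB.pack S (GRing.isLinear.Build _ _ _ _ S S_lin).
exists SL; split=> // f; change (hnorm (S f) <= C * hnorm f).
have [->|Sf0] := eqVneq (hnorm (S f)) 0; first by rewrite mulr_ge0 ?hnorm_ge0.
rewrite -(@ler_pM2r _ (hnorm (S f))) ?lt_neqAle ?hnorm_ge0 1?eq_sym ?Sf0//.
by rewrite -expr2 hnorm_sqr SE -mulrA (le_trans (ler_norm _)).
Qed.

Lemma opnorm_le H1 H2 (A : {linear H1 -> H2}) (C : R) :
  0 <= C -> (forall f, hnorm (A f) <= C * hnorm f) -> opnorm A <= C.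
Proof.
move=> C0 AC; apply: ge_sup.
  by exists (hnorm (A 0)), 0 => //; rewrite /= /hnorm normr0 sRe0.
by move=> _ [f /= f1 <-]; rewrite (le_trans (AC f))// ler_piMr.
Qed.

End Operators.

(** * Integrals *)

Section Integrals.
Context (R : realType) (d : measure_display) (X : measurableType d).
Context (mu : {measure set X -> \bar R}).

Lemma ge0_integrable_le (h : X -> R) (a : R) :
    measurable_fun [set: X] h -> (forall x, 0 <= h x) ->
    (\int[mu]_x (h x)%:E <= a%:E)%E ->
  mu.-integrable [set: X] (EFin \o h) /\ \int[mu]_x h x <= a.
Proof.
move=> mh h0 ha.
have ih : mu.-integrable [set: X] (EFin \o h).
  apply/integrableP; split; first exact/measurable_EFinP.
  under eq_integral do rewrite /= ger0_norm//.
  by rewrite (le_lt_trans ha) ?ltry.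
split=> //; rewrite -lee_fin /Rintegral fineK//.
exact: integrable_fin_num.
Qed.

(** Integrating [0 <= p^2 + 2 t h + t^2 q^2], which holds pointwise for every
    real [t] because [|h| <= p q], gives a nonnegative quadratic polynomial in
    [t].  Measurability is asked of [p^2] and [q^2], the functions that a Bessel
    family makes measurable. *)
Lemma integral_cauchy_schwarz (h p q : X -> R) (a b : R) :
    measurable_fun [set: X] h ->
    measurable_fun [set: X] (fun x => p x ^+ 2) ->
    measurable_fun [set: X] (fun x => q x ^+ 2) ->
    (forall x, `|h x| <= p x * q x) ->
    (\int[mu]_x (p x ^+ 2)%:E <= a%:E)%E ->
    (\int[mu]_x (q x ^+ 2)%:E <= b%:E)%E ->
  mu.-integrable [set: X] (EFin \o h) /\
  `|\int[mu]_x h x| <= Num.sqrt (a * b).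
Proof.
move=> mh mp mq hpq pa qb.
have [ip {}pa] := ge0_integrable_le mp (fun x => sqr_ge0 (p x)) pa.
have [iq {}qb] := ge0_integrable_le mq (fun x => sqr_ge0 (q x)) qb.
have ih : mu.-integrable [set: X] (EFin \o h).
  apply: le_integrable (integrableD measurableT ip iq) => //.
    exact/measurable_EFinP.
  move=> x _ /=; rewrite lee_fin (le_trans (hpq x))//.
  rewrite (le_trans _ (ler_norm _))//.
  have := sqr_ge0 (p x - q x); have := sqr_ge0 (p x + q x); lra.
split=> //; rewrite -sqrtr_sqr ler_wsqrtr//.
have b0 : 0 <= b.
  by apply: le_trans qb; apply: Rintegral_ge0 => x _; exact: sqr_ge0.
apply: discriminant_le b0 _ => t.
apply: (@le_trans _ _
    (\int[mu]_x (p x ^+ 2 + (2 * t * h x + t ^+ 2 * q x ^+ 2)))).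
  apply: Rintegral_ge0 => x _.
  have := ler_wpM2l (normr_ge0 t) (hpq x).
  rewrite -normrM => /(le_trans (ler_norm _)).
  have := ler_norm (- (t * h x)); rewrite normrN normrM.
  have := ler_wpM2l (normr_ge0 t) (hpq x).
  have := sqr_ge0 (p x - `|t| * q x).
  rewrite sqrrB exprMn real_normK ?num_real//; lra.
have ith : mu.-integrable [set: X] (EFin \o (fun x => 2 * t * h x)).
  exact: (integrableZl measurableT (2 * t) ih).
have itq : mu.-integrable [set: X] (EFin \o (fun x => t ^+ 2 * q x ^+ 2)).
  exact: (integrableZl measurableT (t ^+ 2) iq).
rewrite RintegralD//; last exact: (integrableD measurableT ith itq).
rewrite RintegralD// !RintegralZl//.
by rewrite addrA lerD ?lerD// ler_wpM2l ?sqr_ge0.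
Qed.

Context (k : scalar_kind).
Implicit Types h : X -> Defs.scalar R k.

Lemma sRe_sintegral h : sRe (Defs.sintegral mu h) = \int[mu]_x sRe (h x).
Proof. exact: sRe_mk. Qed.

Lemma sIm_sintegral h : sIm (Defs.sintegral mu h) = \int[mu]_x sIm (h x).
Proof. by case: k h => // h /=; rewrite /Rintegral integral0. Qed.

Lemma sintegral_linear (a : Defs.scalar R k) h1 h2 :
    sintegrable mu h1 -> sintegrable mu h2 ->
  Defs.sintegral mu (fun x => a * h1 x + h2 x) =
  a * Defs.sintegral mu h1 + Defs.sintegral mu h2.
Proof.
move=> [r1 i1] [r2 i2].
have Z c (e : X -> R) : mu.-integrable [set: X] (EFin \o e) ->
    mu.-integrable [set: X] (EFin \o (fun x => c * e x)).
  by move=> ie; exact: (integrableZl measurableT c ie).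
have DB c e (e1 e2 : X -> R) : mu.-integrable [set: X] (EFin \o e1) ->
    mu.-integrable [set: X] (EFin \o e2) ->
    mu.-integrable [set: X] (EFin \o (fun x => c * e1 x + e * e2 x)).
  move=> ie1 ie2.
  exact: (integrableD measurableT (Z _ _ ie1) (Z _ _ ie2)).
apply: scalar_ext.
  rewrite sReD sReM !(sRe_sintegral, sIm_sintegral).
  under eq_Rintegral do rewrite sReD sReM -mulNr.
  rewrite RintegralD//; last exact: DB.
  by rewrite RintegralD ?RintegralZl ?mulNr//; exact: Z.
rewrite sImD sImM !(sRe_sintegral, sIm_sintegral).
under eq_Rintegral do rewrite sImD sImM.
rewrite RintegralD//; last exact: DB.
by rewrite RintegralD ?RintegralZl//; exact: Z.
Qed.

End Integrals.

(** * The frame operator *)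

Section FrameIntegrand.
Context (R : realType) (k : scalar_kind) (H : hilbertType R k).
Context (d : measure_display) (X : measurableType d).
Context (T U : {linear H -> H}) (F G : X -> closed_subspace H).
Context (v w : X -> R) (K : X -> hilbertType R k).
Context (Lambda : forall x, {linear csub_elt (F x) -> K x}).
Context (Gamma : forall x, {linear csub_elt (G x) -> K x}).

Let analysisF x f : K x := Lambda x (orth_proj (F x) (T f)).
Let analysisG x g : K x := Gamma x (orth_proj (G x) (U g)).

Context (U_sym : forall f g, inner (U f) g = inner f (U g)).
Context (Gamma_bd : forall x, bounded_operator (Gamma x)).
Local Notation h := (frame_integrand T U Lambda Gamma v w).

(** The adjoint and the projections disappear once everything acting on the
    left is moved to the right; [z], which already lies in [G x], is unchanged
    by the projection. *)
Lemma frame_integrandE f g x :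
  h f g x = mkscalar k (v x * w x) 0 * inner (analysisF x f) (analysisG x g).
Proof.
rewrite /frame_integrand U_sym; congr (_ * _).
set z := adjoint _ _.
rewrite innerC -(inner_orth_proj (U g)) -innerC inner_orth_proj.
by rewrite [LHS](innerC z) -inner_adjoint// -innerC.
Qed.

Lemma frame_integrand_linl g x : linear_for *%R (fun f => h f g x).
Proof.
move=> a f f'; rewrite !frame_integrandE /analysisF.
by rewrite linearP orth_proj_linear linearP innerDl innerZl mulrDr mulrCA.
Qed.

Lemma frame_integrand_linr f x :
  linear_for (@sconj R k \; *%R) (fun g => h f g x).
Proof.
move=> a g g'; rewrite /= !frame_integrandE /analysisG.
by rewrite linearP orth_proj_linear linearP innerDr innerZr mulrDr mulrCA.
Qed.

Context (v_ge0 : forall x, 0 <= v x) (w_ge0 : forall x, 0 <= w x).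

Lemma frame_integrand_le f g x :
  let p := v x * hnorm (analysisF x f) in
  let q := w x * hnorm (analysisG x g) in
  `|sRe (h f g x)| <= p * q /\ `|sIm (h f g x)| <= p * q.
Proof.
move=> p q; rewrite /p /q frame_integrandE sRe_mkM sIm_mkM mulrACA.
rewrite !(normrM (v x * w x)).
rewrite (ger0_norm (mulr_ge0 (v_ge0 x) (w_ge0 x))).
by split; rewrite ler_wpM2l ?mulr_ge0 ?v_ge0 ?w_ge0//;
  rewrite ?cauchy_schwarz ?sIm_inner_le.
Qed.

End FrameIntegrand.

Theorem theorem4p4 (R : realType) (k : scalar_kind) (H : hilbertType R k)
    (d : measure_display) (X : measurableType d)
    (mu : {measure set X -> \bar R})
    (T U : {linear H -> H})
    (F G : X -> closed_subspace H)
    (v w : X -> R)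
    (K : X -> hilbertType R k)
    (Lambda : forall x, {linear csub_elt (F x) -> K x})
    (Gamma : forall x, {linear csub_elt (G x) -> K x})
    (B D : R)
    (separable_H : separable_space H)
    (T_GB : GBplus T) (U_GB : GBplus U)
    (F_meas : weakly_measurable F) (G_meas : weakly_measurable G)
    (v_meas : measurable_fun [set: X] v) (v_ge0 : forall x, 0 <= v x)
    (w_meas : measurable_fun [set: X] w) (w_ge0 : forall x, 0 <= w x)
    (Lambda_bounded : forall x, bounded_operator (Lambda x))
    (Gamma_bounded : forall x, bounded_operator (Gamma x))
    (Lambda_bessel : gfusion_bessel mu T Lambda v B)
    (Gamma_bessel : gfusion_bessel mu U Gamma w D)
    (integrand_meas : forall f g,
       smeasurable (frame_integrand T U Lambda Gamma v w f g)) :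
  (forall f g, sintegrable mu (frame_integrand T U Lambda Gamma v w f g)) /\
  exists S : {linear H -> H},
    [/\ forall S' : H -> H,
          is_frame_operator mu T U Lambda Gamma v w S' <-> S' =1 S,
        bounded_operator S &
        opnorm S <= Num.sqrt (B * D)].
Proof.
have [[U_sym _] _ _] := U_GB.
set h := frame_integrand T U Lambda Gamma v w.
have bessel_sqr (T' : {linear H -> H}) (F' : X -> closed_subspace H)
    (L : forall x, {linear csub_elt (F' x) -> K x}) u C f :
    gfusion_bessel mu T' L u C ->
    let p x := u x * hnorm (L x (orth_proj (F' x) (T' f))) in
    measurable_fun [set: X] (fun x => p x ^+ 2) /\
    (\int[mu]_x (p x ^+ 2)%:E <= (C * hnorm f ^+ 2)%:E)%E.
  move=> /(_ f); rewrite (_ : bessel_integrand _ _ _ _ = fun x =>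
    (u x * hnorm (L x (orth_proj (F' x) (T' f)))) ^+ 2)//.
  by apply/funext => x; rewrite exprMn hnorm_sqr.
have h_bd f g : sintegrable mu (h f g) /\
    `|sRe (Defs.sintegral mu (h f g))|
      <= Num.sqrt (B * D) * (hnorm f * hnorm g).
  have [mp pB] := bessel_sqr _ _ _ _ _ f Lambda_bessel.
  have [mq qD] := bessel_sqr _ _ _ _ _ g Gamma_bessel.
  have [mre mim] := integrand_meas f g.
  have hle x :=
    frame_integrand_le T Lambda U_sym Gamma_bounded v_ge0 w_ge0 f g x.
  have [ire re_le] :=
    integral_cauchy_schwarz mre mp mq (fun x => (hle x).1) pB qD.
  have [iim _] :=
    integral_cauchy_schwarz mim mp mq (fun x => (hle x).2) pB qD.
  split; first by split.
  (* [sqrtrM] asks for the nonnegativity of one factor only, and the square is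
     put first because the sign of [B * D] is unknown when [H] is trivial. *)
  rewrite sRe_sintegral (le_trans re_le)// mulrACA -exprMn mulrC.
  by rewrite sqrtrM ?sqr_ge0// sqrtr_sqr ger0_norm ?mulr_ge0 ?hnorm_ge0// mulrC.
have int_h f g : sintegrable mu (h f g) by have [] := h_bd f g.
split=> //.
have linl g : linear_for *%R (fun f => Defs.sintegral mu (h f g)).
  move=> a f f'; rewrite -sintegral_linear//; congr (Defs.sintegral mu _).
  by apply/funext => x; exact: frame_integrand_linl.
have linr f :
    linear_for (@sconj R k \; *%R) (fun g => Defs.sintegral mu (h f g)).
  move=> a g g'; rewrite /= -sintegral_linear//; congr (Defs.sintegral mu _).
  by apply/funext => x; exact: frame_integrand_linr.
have [S [SE S_le]] := bounded_form_operator (sqrtr_ge0 _) linl linr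
  (fun f g => (h_bd f g).2).
exists S; split.
- move=> S'; split=> [S'E f|S'S f g]; last by rewrite S'S SE.
  by apply: inner_injl => g; rewrite S'E SE.
- by exists (Num.sqrt (B * D)).
- exact: opnorm_le (sqrtr_ge0 _) S_le.
Qed.
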